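(* For every positive integer $N$, $$\sum_{\lambda\in\mathcal{ROP}_N} t^{\ell(\lambda)}q^{|\lambda|}=\sum_{\mu\in\mathcal{RL}_N} t^{|\mu|_a}q^{|\mu|}=\prod_{k=1}^{N}\frac{1-t^{N-k+1}q^{\Diamond_{N,k}}}{1-tq^{2k-1}}$$ as formal power series in $t,q$.
   Context: A partition is a finite weakly decreasing sequence $\lambda=(\lambda_1\ge\lambda_2\ge\dots\ge\lambda_\ell>0)$ of positive integers (the empty partition $\emptyset$ is allowed); $\ell(\lambda)=\ell$ is its length, $|\lambda|=\sum_i\lambda_i$ its size, and $m_i(\lambda)$ the multiplicity of $i$ as a part. Partitions are identified with sequences obtained by appending zeros. The alternating size is $|\lambda|_a=\sum_{k=1}^{\ell(\lambda)}(-1)^{k+1}\lambda_k$. Trapezoidal numbers: for positive integers $k\le n$, $\Diamond_{n,k}=n+(n-1)+\dots+(n-2k+2)$ if $k\le n/2$, and $\Diamond_{n,k}=n+(n-1)+\dots+(2k-n-1)$ if $k>n/2$ (sums over all consecutive integers between the two ends). Lecture hall partitions. For a positive integer $N$, $\mathcal{L}_N$ is the set of partitions $\mu$ with $\ell(\mu)\le N$ and $$\frac{\mu_1}{N}\ge\frac{\mu_2}{N-1}\ge\dots\ge\frac{\mu_{\ell(\mu)}}{N-\ell(\mu)+1}$$ ($\emptyset\in\mathcal{L}_N$). A partition $\mu\in\mathcal{L}_N$ is reduced if for every $i$ with $1\le i\le \ell(\mu)$ the sequence obtained from $\mu$ by replacing $\mu_i$ with $\mu_i-(N-i+1)$ (and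 leaving the other entries unchanged) is not in $\mathcal{L}_N$; here trailing zeros are deleted, and a sequence that is not a partition is not in $\mathcal{L}_N$. $\mathcal{RL}_N$ is the set of reduced elements of $\mathcal{L}_N$. Odd partitions. $\mathcal{OP}_N$ is the set of partitions all of whose parts are odd and at most $2N$, and $\mathcal{ROP}_N=\{\lambda\in\mathcal{OP}_N : m_{2k-1}(\lambda)\le N-k \text{ for all } 1\le k\le N\}$. *)

(* Defs.v *)
From HB Require Import structures.
From mathcomp Require Import all_boot all_order all_algebra.
From mathcomp Require Import boolp classical_sets cardinality fsbigop.

Set Implicit Arguments.
Unset Strict Implicit.
Unset Printing Implicit Defensive.

Import Order.TTheory GRing.Theory Num.Theory.
Local Open Scope ring_scope.

(* {fps R}: the ring R[[X]] of formal power series, with the Cauchy product.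
   Series in two variables t, q are elements of {fps {fps int}} = Z[[t]][[q]]:
   the outer variable is q, the inner one is t. *)

Record fps (R : Type) := FPS { fpscoef : nat -> R }.

Notation "{ 'fps' R }" := (fps R) (at level 0, format "{ 'fps'  R }").

Lemma fpsP (R : Type) (f g : {fps R}) : fpscoef f =1 fpscoef g -> f = g.
Proof. by case: f g => [f] [g] /= /funext ->. Qed.

HB.instance Definition _ (R : Type) := gen_eqMixin {fps R}.
HB.instance Definition _ (R : Type) := gen_choiceMixin {fps R}.

Section Zmodule.
Variable R : zmodType.
Implicit Types f g h : {fps R}.

Definition fps_zero : {fps R} := FPS (fun _ => 0).
Definition fps_opp f : {fps R} := FPS (fun n => - fpscoef f n).
Definition fps_add f g : {fps R} := FPS (fun n => fpscoef f n + fpscoef g n).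

Fact fps_addA : associative fps_add.
Proof. by move=> f g h; apply: fpsP => n /=; rewrite addrA. Qed.
Fact fps_addC : commutative fps_add.
Proof. by move=> f g; apply: fpsP => n /=; rewrite addrC. Qed.
Fact fps_add0 : left_id fps_zero fps_add.
Proof. by move=> f; apply: fpsP => n /=; rewrite add0r. Qed.
Fact fps_addN : left_inverse fps_zero fps_opp fps_add.
Proof. by move=> f; apply: fpsP => n /=; rewrite addNr. Qed.

HB.instance Definition _ :=
  GRing.isZmodule.Build {fps R} fps_addA fps_addC fps_add0 fps_addN.

End Zmodule.

Section Ring.
Variable R : comNzRingType.
Implicit Types f g h : {fps R}.

Definition fps_const (c : R) : {fps R} :=
  FPS (fun n => if n == 0%N then c else 0).
Definition fps_var : {fps R} := FPS (fun n => (n == 1%N)%:R).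
Definition fps_mul f g : {fps R} :=
  FPS (fun n => \sum_(i < n.+1) fpscoef f i * fpscoef g (n - i)).

Let trunc n f : {poly R} := \poly_(i < n.+1) fpscoef f i.

Let trunc_coef n f i : (i <= n)%N -> (trunc n f)`_i = fpscoef f i.
Proof. by move=> le_in; rewrite coef_poly ltnS le_in. Qed.

Let mul_trunc n f g i : (i <= n)%N ->
  fpscoef (fps_mul f g) i = (trunc n f * trunc n g)`_i.
Proof.
move=> le_in; rewrite coefM; apply: eq_bigr => j _.
by rewrite !trunc_coef // (leq_trans _ le_in) ?leq_subr // -ltnS.
Qed.

Fact fps_mulA : associative fps_mul.
Proof.
move=> f g h; apply: fpsP => n.
transitivity ((trunc n f * (trunc n g * trunc n h))`_n).
  rewrite coefM; apply: eq_bigr => i _.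
  by rewrite (@mul_trunc n) ?leq_subr // trunc_coef // -ltnS.
rewrite mulrA coefM; apply: eq_bigr => i _.
have le_in : (i <= n)%N by rewrite -ltnS.
by rewrite -(mul_trunc f g le_in) trunc_coef ?leq_subr.
Qed.

Fact fps_mulC : commutative fps_mul.
Proof. by move=> f g; apply: fpsP => n; rewrite !(@mul_trunc n) // mulrC. Qed.

Fact fps_mul1 : left_id (fps_const 1) fps_mul.
Proof.
move=> f; apply: fpsP => n /=.
rewrite big_ord_recl /= mul1r subn0 big1 ?addr0 // => i _.
by rewrite mul0r.
Qed.

Fact fps_mulD : left_distributive fps_mul +%R.
Proof.
move=> f g h; apply: fpsP => n /=; rewrite -big_split /=.
by apply: eq_bigr => i _; rewrite mulrDl.
Qed.

Fact fps_oner_neq0 : fps_const 1 != 0.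
Proof.
apply/eqP => /(congr1 (fun f : {fps R} => fpscoef f 0)) /= /eqP.
by rewrite oner_eq0.
Qed.

HB.instance Definition _ := GRing.Zmodule_isComNzRing.Build {fps R}
  fps_mulA fps_mulC fps_mul1 fps_mulD fps_oner_neq0.

Definition fps_unit : {pred {fps R}} := fun f => `[< exists g, g * f = 1 >].
Definition fps_inv f : {fps R} := xget f [set g | g * f = 1]%classic.

Fact fps_mulV : {in fps_unit, left_inverse 1 fps_inv *%R}.
Proof.
by move=> f /asboolP [g gf]; rewrite /fps_inv; case: xgetP => [//|/(_ g)].
Qed.

Fact fps_unitPl f g : g * f = 1 -> fps_unit f.
Proof. by move=> gf; apply/asboolP; exists g. Qed.

Fact fps_inv_out : {in [predC fps_unit], fps_inv =1 id}.
Proof.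
move=> f /asboolP nUf; rewrite /fps_inv; case: xgetP => // g _ gf.
by case: nUf; exists g.
Qed.

HB.instance Definition _ := GRing.ComNzRing_hasMulInverse.Build {fps R}
  fps_mulV fps_unitPl fps_inv_out.

Let inv_seq f :=
  fix s n : seq R := if n is m.+1 then
    rcons (s m) ((m == 0%N)%:R
                 - \sum_(i < m) fpscoef f (m - i) * nth 0 (s m) i)
  else [::].

Let size_inv_seq f n : size (inv_seq f n) = n.
Proof. by elim: n => //= n IHn; rewrite size_rcons IHn. Qed.

Let nth_inv_seq f n i : (i < n)%N ->
  nth 0 (inv_seq f n) i = nth 0 (inv_seq f i.+1) i.
Proof.
elim: n => // n IHn; rewrite ltnS leq_eqVlt => /predU1P [-> //|lt_in].
by rewrite -IHn //= nth_rcons size_inv_seq lt_in.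
Qed.

Lemma fps_unit1 f : fpscoef f 0 = 1 -> f \is a GRing.unit.
Proof.
move=> f0; pose g : {fps R} := FPS (fun n => nth 0 (inv_seq f n.+1) n).
suff gf : g * f = 1 by apply: (fps_unitPl gf).
apply: fpsP => n; change (fpscoef (fps_mul g f) n = if n == 0%N then 1 else 0).
rewrite /= big_ord_recr /= subnn f0 mulr1.
rewrite nth_rcons size_inv_seq ltnn eqxx addrC.
rewrite [X in _ + X](eq_bigr (fun i : 'I_n =>
  fpscoef f (n - i) * nth 0 (inv_seq f n) i)) => [|i _].
  by rewrite subrK; case: (n == _).
by rewrite mulrC (nth_inv_seq f (ltn_ord i)).
Qed.

End Ring.

(* Sum of a family of series in which every coefficient receives only finitely
   many nonzero contributions. *)
Definition fps_sum (R : zmodType) (T : choiceType) (A : set T)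
    (F : T -> {fps R}) : {fps R} :=
  FPS (fun n => \sum_(x \in A) fpscoef (F x) n).

Definition tvar : {fps {fps int}} := fps_const (fps_var int).
Definition qvar : {fps {fps int}} := fps_var {fps int}.

Lemma unit_1Btq (k : nat) : (0 < k)%N ->
  1 - tvar * qvar ^+ k \is a GRing.unit.
Proof.
case: k => // k _; apply: fps_unit1.
have -> : fpscoef (1 - tvar * qvar ^+ k.+1) 0
    = 1 - fpscoef (fps_mul tvar (fps_mul qvar (qvar ^+ k))) 0.
  by rewrite exprS.
by rewrite /= !big_ord_recr !big_ord0 /= mul0r !add0r mulr0 subr0.
Qed.

Section Partitions.
Local Open Scope nat_scope.

Definition is_partition (s : seq nat) : bool :=
  sorted geq s && all (ltn 0) s.

Definition altsum (s : seq nat) : int :=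
  (\sum_(k < size s) (-1) ^+ k * (nth 0%N s k)%:Z)%R.

Lemma altsum_ge0 (s : seq nat) : is_partition s -> (0 <= altsum s)%R.
Proof.
have altsum_cons x u : altsum (x :: u) = (x%:Z - altsum u)%R.
  rewrite /altsum big_ord_recl /= expr0 mul1r; congr (_ + _)%R.
  rewrite -sumrN; apply: eq_bigr => i _.
  by rewrite /= /bump leq0n add1n exprS mulN1r mulNr.
suff H x u : path geq x u -> (0 <= altsum u <= x%:Z)%R.
  by case: s => [|x u] /andP[]; rewrite ?altsum_cons ?subr_ge0;
    [rewrite /altsum big_ord0 | move=> /H /andP[]].
elim: u x => [|y u IHu] x /=; first by rewrite /altsum big_ord0 lexx.
move=> /andP[yx /IHu /andP[u0 uy]]; rewrite altsum_cons subr_ge0 uy /=.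
by rewrite lerBlDr (le_trans (_ : _ <= x%:Z)%R) ?lez_nat ?lerDl.
Qed.

(* The absolute value only casts from int to nat, by altsum_ge0. *)
Definition alt_size (s : seq nat) : nat := `|altsum s|.

Definition trapezoidal (n k : nat) : nat :=
  if 2 * k <= n then \sum_(n - 2 * k + 2 <= i < n.+1) i
  else \sum_(2 * k - n - 1 <= i < n.+1) i.

(* Parts are indexed from 0: the denominator N - i belongs to nth 0 s i. *)
Definition lecture_hall (N : nat) : set (seq nat) :=
  [set s | [/\ is_partition s, size s <= N &
    forall i, i.+1 < size s ->
      ((nth 0%N s i.+1)%:R / (N - i.+1)%:R
         <= (nth 0%N s i)%:R / (N - i)%:R :> rat)%R]]%classic.

Fixpoint strip_zeros (s : seq nat) : seq nat :=
  if s is x :: s' then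
    let r := strip_zeros s' in if (x == 0) && nilp r then [::] else x :: r
  else [::].

(* The first conjunct under the negation excludes a negative new entry. *)
Definition reduced_lecture_hall (N : nat) : set (seq nat) :=
  [set s | lecture_hall N s /\ forall i, i < size s ->
    ~ (N - i <= nth 0 s i /\
       lecture_hall N (strip_zeros (set_nth 0 s i (nth 0 s i - (N - i)))))
  ]%classic.

Definition odd_partitions (N : nat) : set (seq nat) :=
  [set s | is_partition s /\ forall p, p \in s -> odd p /\ p <= 2 * N]%classic.

Definition reduced_odd_partitions (N : nat) : set (seq nat) :=
  [set s | odd_partitions N s /\
    forall k, 1 <= k <= N -> count_mem (2 * k - 1) s <= N - k]%classic.

End Partitions.

(* Main.v *)
Require Import Defs.
From mathcomp Require Import all_boot all_order all_algebra.
From mathcomp Require Import boolp classical_sets cardinality fsbigop.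
From mathcomp Require Import zify ring.
Import Order.TTheory GRing.Theory Num.Theory.

(* Pad a reduced lecture hall partition with zeros to length N. Given the
   entries after it, the entry of denominator d ranges over exactly d
   consecutive integers starting at the least value [low] the lecture hall
   condition allows, and reducedness is the upper end of that window. The
   conditions tying the entries 2, 4, 6, ... to their neighbours are invariant
   under reflecting each of these entries in the interval its neighbours allow
   ([reflect_even]). Hence mu |-> low + s :: reflect_even mu with 0 <= s <= N is
   a bijection from [0, N] x RL_N onto RL_(N+1); it adds s to the alternating
   size, and it adds s plus twice the old alternating size to the size. Adding 2
   to every part of a reduced odd partition and appending s ones changes the
   length and the size in the same way, so both sums satisfy the recursion of a
   product of finite geometric series. *)

(** * Trapezoidal numbers, windows of admissible entries, and reflection *)

Section PaddedReduced.
Local Open Scope nat_scope.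

Lemma double_sum_nat a b : a <= b -> 2 * \sum_(a <= i < b) i = (b - a) * (a + b).-1.
Proof.
elim: b => [|b IHb]; first by rewrite leqn0 => /eqP->; rewrite big_geq.
rewrite leq_eqVlt => /predU1P[->|]; first by rewrite big_geq ?subnn.
by rewrite ltnS => le_ab; rewrite big_nat_recr //= mulnDr IHb //; nia.
Qed.

(** There are [2 * k - 1] terms of mean [N - k + 1], or [2 * (N - k + 1)] terms of mean half of
    [2 * k - 1]. The product form makes the numerator [1 - z ^+ (N - k + 1)] for z = t q^(2k-1). *)
Lemma trapezoidalE N k : 1 <= k <= N -> trapezoidal N k = (2 * k - 1) * (N - k + 1).
Proof.
move=> /andP[k1 kN]; apply/eqP; rewrite -(eqn_pmul2l (isT : 0 < 2)); apply/eqP.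
rewrite /trapezoidal; case: ifP => kN2; rewrite double_sum_nat; try lia.
- rewrite (_ : _ - _ = 2 * k - 1); last lia.
  by rewrite (_ : (_ + _).-1 = 2 * (N - k + 1)); lia.
- rewrite (_ : _ - _ = 2 * (N - k + 1)); last lia.
  by rewrite (_ : (_ + _).-1 = 2 * k - 1); lia.
Qed.

(* [low m y] is the least x with y/m <= x/(m+1), and [up m x] is
   the greatest such y. For the last entry m = 0 and y = 0, and the
   junk value x %/ 0 = 0 makes the bound 0. *)
Definition low m y := y + (y + m.-1) %/ m.
Definition up m x := (m * x) %/ m.+1.

Lemma leq_low m x y : 0 < m -> (low m y <= x) = (y * m.+1 <= x * m).
Proof.
move=> m0; rewrite /low.
have E := divn_eq (y + m.-1) m; have L := ltn_pmod (y + m.-1) m0.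
by apply/idP/idP; nia.
Qed.

Lemma low_up m x y : 0 < m -> (low m y <= x) = (y <= up m x).
Proof. by move=> m0; rewrite leq_low // leq_divRL // (mulnC x). Qed.

Lemma low0 m : low m 0 = 0.
Proof. by rewrite /low; case: m => //= m; rewrite divn_small. Qed.

(* ceil(x/(m+1)) + floor(m x/(m+1)) = x. *)
Lemma low_addn_up m x : low m.+1 x + up m x = 2 * x.
Proof.
rewrite /low /up /=.
have E := divn_eq (x + m) m.+1; have L := ltn_pmod (x + m) (ltn0Sn m).
have E' := divn_eq (m * x) m.+1; have L' := ltn_pmod (m * x) (ltn0Sn m).
nia.
Qed.

(* [s] is a reduced lecture hall partition for N = size s, padded with zeros. *)
Fixpoint padded_reduced (s : seq nat) : bool :=
  if s is x :: s' then
    let l := low (size s') (head 0 s') in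
    [&& padded_reduced s', l <= x & x < l + (size s').+1]
  else true.

(* Reflects every second entry in the interval its two neighbours allow. *)
Fixpoint reflect_even (s : seq nat) : seq nat :=
  if s is a :: b :: s' then
    a :: (low (size s') (head 0 s') + up (size s').+1 a - b) :: reflect_even s'
  else s.

Lemma seq2_ind (P : seq nat -> Prop) :
  P [::] -> (forall a, P [:: a]) -> (forall a b s, P s -> P [:: a, b & s]) ->
  forall s, P s.
Proof.
move=> P0 P1 P2 s; suff [] : P s /\ forall a, P (a :: s) by [].
by elim: s => [|b s [Ps IHs]]; split=> // a; apply: P2.
Qed.

Lemma size_reflect_even s : size (reflect_even s) = size s.
Proof. by elim/seq2_ind: s => //= a b s ->. Qed.

Lemma head_reflect_even s : head 0 (reflect_even s) = head 0 s.
Proof. by case: s => [|a []]. Qed.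

(** The map b |-> l + u - b preserves [l <= b <= u] and exchanges the last two inequalities, so in
    this form the invariance under reflection is visible. *)
Lemma padded_reduced2 a b s (l := low (size s) (head 0 s))
    (u := up (size s).+1 a) :
  padded_reduced [:: a, b & s] =
  [&& padded_reduced s, l <= b <= u & (u < b + (size s).+1) && (b < l + (size s).+1)].
Proof.
have m0 : 0 < (size s).+1 by [].
(* Write m for [(size s).+1]. If a > m, lowering [a] by m + 1 lowers [up m a] by m, and [leq_low]
   applies; if a <= m, then [u < m] and both sides hold. *)
have E : (a < low (size s).+1 b + (size s).+2) = (u < b + (size s).+1).
  have := divn_eq ((size s).+1 * a) (size s).+2.
  have := ltn_pmod ((size s).+1 * a) (ltn0Sn (size s).+1).
  rewrite -/(up _ a) -/u; case: (leqP (size s).+2 a) => ha.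
    have := leq_low (size s).+1 (a - (size s).+2) b m0; rewrite mulnBl.
    by move: (low _ _) => L; nia.
  by nia.
by rewrite /= -/l low_up // E -/u -!andbA; do !bool_congr.
Qed.

Lemma reflect_evenK s : padded_reduced s -> reflect_even (reflect_even s) = s.
Proof.
elim/seq2_ind: s => // a b s IHs; rewrite padded_reduced2 => /and3P[/IHs Ts lbu _].
rewrite /= Ts size_reflect_even head_reflect_even; congr [:: _, _ & _].
by move: lbu; set l := low _ _; set u := up _ _; lia.
Qed.

Lemma padded_reduced_reflect_even s :
  padded_reduced s -> padded_reduced (reflect_even s).
Proof.
elim/seq2_ind: s => // a b s IHs; rewrite [reflect_even _]/= !padded_reduced2.
move=> /and3P[/IHs-> ]; rewrite size_reflect_even head_reflect_even.
by set l := low _ _; set u := up _ _; lia.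
Qed.

Lemma altsum_cons x s : (altsum (x :: s) = x%:Z - altsum s)%R.
Proof.
rewrite /altsum big_ord_recl /= expr0 mul1r; congr (_ + _)%R.
rewrite -sumrN; apply: eq_bigr => i _.
by rewrite /= /bump leq0n add1n exprS mulN1r mulNr.
Qed.

(** Adding two entries cancels the old [low], and [low_addn_up] trades the [up] of the new first
    entry for its [low]. *)
Lemma altsum_sumn_reflect_even s (l := low (size s) (head 0 s)) :
  padded_reduced s ->
  (altsum (reflect_even s) = l%:Z - altsum s
   /\ (sumn (reflect_even s))%:Z = (sumn s)%:Z + 2 * altsum s - l%:Z)%R.
Proof.
rewrite /l {l}; elim/seq2_ind: s => [_|a _|a b s IHs].
- by rewrite /altsum big_ord0.
- rewrite !altsum_cons /altsum big_ord0 /=.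
  have := low_addn_up 0 a; rewrite /up mul0n div0n addn0 => ->; lia.
rewrite padded_reduced2 => /and3P[/IHs]; rewrite [reflect_even _]/= !altsum_cons /=.
have := low_addn_up (size s).+1 a.
rewrite -/reflect_even; move: (low (size s) _) (low _ _) (up _ _) => l l' u; lia.
Qed.

Lemma padded_reducedS n (la : seq nat) :
  (size la = n.+1 /\ padded_reduced la) <->
  exists s mu, [/\ s <= n, size mu = n /\ padded_reduced mu
    & la = (low n (head 0 mu) + s) :: reflect_even mu].
Proof.
split=> [[]|[s [mu [le_sn [sz Pmu] ->]]]]; last first.
  rewrite /= size_reflect_even sz head_reflect_even padded_reduced_reflect_even //.
  by split=> //=; lia.
case: la => // x mu [sz] /= /and3P[Pmu lx ux]; rewrite sz in lx ux.
(* Reflection is an involution that keeps the head, so the reflected tail has the same lower bound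
   for [x]. *)
exists (x - low n (head 0 mu)), (reflect_even mu).
rewrite size_reflect_even head_reflect_even padded_reduced_reflect_even //.
by rewrite reflect_evenK // subnKC //; split=> //; lia.
Qed.

End PaddedReduced.

(** * From a recursion on statistics to a product of geometric sums *)

Section GeneratingFunction.
Local Open Scope ring_scope.

(* With [t := t q^2] in the smaller object, the recursion on the statistics
   reads [G_(n+1)(t, q) = (\sum_(s <= n) (t q)^s) G_n(t q^2, q)]. *)
Lemma gf_of_recursion (T : eqType) (A : nat -> set T) (e : T)
    (f : nat -> nat -> T -> T) (a w : T -> nat) :
  a e = 0%N -> w e = 0%N -> (forall x, A 0%N x <-> x = e) ->
  (forall n x, A n.+1 x <-> exists s m, [/\ (s <= n)%N, A n m & x = f n s m]) ->
  (forall n s s' m m', A n m -> A n m' -> f n s m = f n s' m' ->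
     s = s' /\ m = m') ->
  (forall n s m, A n m ->
     a (f n s m) = (a m + s)%N /\ w (f n s m) = (w m + 2 * a m + s)%N) ->
  forall n, exists L : seq T, [/\ uniq L, forall x, x \in L <-> A n x &
    forall (R : comPzRingType) (t q : R),
      \sum_(x <- L) t ^+ a x * q ^+ w x =
      \prod_(1 <= k < n.+1) \sum_(s < (n - k + 1)%N) (t * q ^+ (2 * k - 1)) ^+ s].
Proof.
move=> ae we A0 AS inj_f stat; elim=> [|n [L [uL AL gfL]]].
  exists [:: e]; split=> // [x|R t q]; first by rewrite A0 inE; split=> /eqP.
  by rewrite big_seq1 ae we big_geq ?mulr1.
exists [seq f n s m | s <- iota 0 n.+1, m <- L]; split=> [|x|R t q].
- apply: allpairs_uniq => //; first exact: iota_uniq.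
  by move=> [s m] [s' m'] /allpairsP[[s1 m1] [_ /AL Am [-> ->]]]
    /allpairsP[[s2 m2] [_ /AL Am' [-> ->]]] /inj_f[] //= -> ->.
- rewrite AS; split=> [/allpairsP[[s m] [si /AL Am ->]]|[s [m [ls /AL mL ->]]]].
    by exists s, m; split=> //; rewrite mem_iota in si.
  by apply/allpairsP; exists (s, m); rewrite mem_iota.
rewrite big_allpairs_dep -[iota 0 n.+1]/(index_iota 0 n.+1) big_mkord.
rewrite big_ltn // big_add1 [n.+2.-1]/= subSS subn0 addn1 mulr_suml.
apply: eq_bigr => s _.
(* The factors with k >= 2 are those for [n] at t q^2; the induction hypothesis is general in [t]
   for this purpose. *)
have shift k : (1 <= k < n.+1)%N -> \sum_(i < (n.+1 - k.+1 + 1)%N)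
      (t * q ^+ (2 * k.+1 - 1)) ^+ i
    = \sum_(i < (n - k + 1)%N) (t * q ^+ 2 * q ^+ (2 * k - 1)) ^+ i.
  move=> /andP[k1 _]; rewrite subSS; apply: eq_bigr => i _.
  by rewrite -mulrA -exprD; congr ((_ * _ ^+ _) ^+ _); lia.
rewrite (eq_big_nat _ _ shift) -gfL mulr_sumr.
apply: eq_big_seq => m /AL /(stat n s)[-> ->].
by rewrite (_ : 2 * 1 - 1 = 1)%N // expr1 !exprMn mul2n -addnn !exprD; ring.
Qed.

Lemma geometric_quotient (R : comUnitRingType) (z : R) m :
  1 - z \is a GRing.unit -> \sum_(s < m) z ^+ s = (1 - z ^+ m) / (1 - z).
Proof.
move=> Uz; apply: (mulIr Uz); rewrite divrK // -[1 - z ^+ m]opprB subrX1.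
by rewrite -mulNr opprB mulrC.
Qed.

Lemma fps_sum_seq (R : comNzRingType) (T : choiceType) (A : set T) (L : seq T)
    (F : T -> {fps R}) :
  uniq L -> (forall x, x \in L <-> A x) -> fps_sum A F = \sum_(x <- L) F x.
Proof.
move=> uL AL; have -> : A = [set` L]%classic by apply/predeqP => x; rewrite -AL.
apply: fpsP => n; rewrite /= -fsbig_seq //.
by rewrite (big_morph (fun f : {fps R} => fpscoef f n) (id1 := 0) (op1 := +%R)).
Qed.

End GeneratingFunction.

(** * The recursion for reduced odd partitions *)

Section OddPartitions.
Local Open Scope nat_scope.

Lemma reduced_odd_partitions0 la : reduced_odd_partitions 0 la <-> la = [::].
Proof.
split=> [|->]; last by split=> [|k]; [split | lia].
by case: la => [//|x la] [[_ /(_ x)]]; rewrite mem_head => /(_ isT) [] + +; case: x.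
Qed.

Definition add_ones (s : nat) (la : seq nat) := map (addn 2) la ++ nseq s 1.

Lemma size_add_ones s la : size (add_ones s la) = size la + s.
Proof. by rewrite size_cat size_map size_nseq. Qed.

Lemma sumn_add_ones s la : sumn (add_ones s la) = sumn la + 2 * size la + s.
Proof.
rewrite sumn_cat sumn_nseq mul1n; congr (_ + _).
by elim: la => //= x la ->; lia.
Qed.

Lemma count_mem1_add_ones s la : count_mem 1 (add_ones s la) = s.
Proof.
rewrite count_cat count_nseq count_map (eq_count (a2 := pred0)) => [|[]//].
by rewrite count_pred0 mul1n.
Qed.

Lemma count_mem_add_ones s la p :
  0 < p -> count_mem p.+2 (add_ones s la) = count_mem p la.
Proof.
by move=> p0; rewrite count_cat count_nseq mul0n addn0 count_map; apply: eq_count.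
Qed.

(** The shifted parts are at least 2, so the number of ones recovers [s]. *)
Lemma add_ones_inj s s' la la' :
  add_ones s la = add_ones s' la' -> s = s' /\ la = la'.
Proof.
move=> E; have es : s = s' by rewrite -(count_mem1_add_ones s la) E count_mem1_add_ones.
split=> //; have sz : size la = size la'.
  by have := congr1 size E; rewrite !size_add_ones es => /addIn.
move/eqP: E; rewrite eqseq_cat ?size_map // => /andP[/eqP + _].
by apply: inj_map => x y [].
Qed.

Lemma sorted_add_ones s la : sorted geq (add_ones s la) = sorted geq la.
Proof.
have geq_tr : transitive geq by move=> x y z /= xy yz; apply: leq_trans yz xy.
rewrite !sorted_pairwise // pairwise_cat pairwise_map.
rewrite (_ : allrel _ _ _) /=; last by
  apply/allrelP => _ _ /mapP[x _ ->] /nseqP[-> _].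
rewrite (_ : pairwise geq (nseq s 1)) ?andbT; last first.
  by elim: s => //= s ->; rewrite andbT all_nseq /= orbT.
by apply: eq_pairwise => x y; rewrite /= leq_add2l.
Qed.

Lemma decompose_ones la : is_partition la -> exists s mu, la = add_ones s mu.
Proof.
move=> /andP[]; elim: la => [|x la IHla]; first by exists 0, [::].
move=> sla /= /andP[x0 /(IHla (path_sorted sla))[s [mu E]]].
case: x x0 sla => [//|[|x]] _ sla; last by exists s, (x :: mu); rewrite E.
(* After a leading 1 no part exceeds 1, which forces [mu] to be empty. *)
exists s.+1, [::]; rewrite E; case: mu E sla => [//|y mu] ->.
by rewrite /= /addn.
Qed.

(** The multiplicity bound on ones is [s <= n], and the bound for k + 1 at n + 1 is the bound for k
    at n. *)
Lemma reduced_odd_partitionsS n la : reduced_odd_partitions n.+1 la <->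
  exists s mu, [/\ s <= n, reduced_odd_partitions n mu & la = add_ones s mu].
Proof.
split=> [[[Pla Ola] cla]|[s [mu [le_sn [[/andP[smu pmu] Omu] cmu] ->]]]].
  have [s [mu E]] := decompose_ones _ Pla; exists s, mu; subst la.
  have O x : x \in mu -> odd x /\ x <= 2 * n.
    move=> xmu; have /Ola[] : x.+2 \in add_ones s mu.
      by rewrite mem_cat (map_f (addn 2)).
    by rewrite /= negbK => -> ?; split=> //; lia.
  split=> //.
  - by have := cla 1; rewrite count_mem1_add_ones subSS subn0; apply.
  - split=> [|k /andP[k1 kn]]; last first.
      have := cla k.+1; rewrite (_ : 2 * k.+1 - 1 = (2 * k - 1).+2); last lia.
      by rewrite count_mem_add_ones ?subSS; [apply; lia | lia].
    (* A part 2 of [la] would leave a 0 in [mu]; oddness excludes it. *)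
    split=> //; rewrite /is_partition -(sorted_add_ones s) (andP Pla).1 /=.
    by apply/allP => x /O[]; case: x.
split=> [|[|[|k]] // kn].
- split=> [|p]; last first.
    rewrite mem_cat => /orP[/mapP[x /Omu[ox xn] ->]|/nseqP[-> _]]; last by lia.
    by rewrite /= negbK; split=> //; lia.
  rewrite /is_partition sorted_add_ones smu all_cat all_nseq orbT andbT.
  by apply/allP => _ /mapP[x _ ->].
- by rewrite count_mem1_add_ones subSS subn0.
- rewrite (_ : 2 * k.+2 - 1 = (2 * k.+1 - 1).+2); last lia.
  by rewrite count_mem_add_ones ?(subSS k.+1 n); [apply: cmu; lia | lia].
Qed.
End OddPartitions.

(** * Reduced lecture hall partitions as padded sequences *)

Section LectureHall.
Local Open Scope nat_scope.

Lemma strip_zeros_cat s : s = strip_zeros s ++ nseq (size s - size (strip_zeros s)) 0.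
Proof.
elim: s => //= x s IHs; case: ifP => [/andP[/eqP-> /nilP E]|_]; last first.
  by rewrite /= subSS -IHs.
by rewrite {1}IHs E /= subn0.
Qed.

Lemma nth_strip_zeros s i : nth 0 (strip_zeros s) i = nth 0 s i.
Proof.
rewrite [in RHS](strip_zeros_cat s) nth_cat nth_nseq.
by case: ltnP => // ?; rewrite nth_default ?if_same.
Qed.

Lemma size_strip_zeros s : size (strip_zeros s) <= size s.
Proof. by elim: s => //= x s IHs; case: ifP. Qed.

Lemma sumn_strip_zeros s : sumn (strip_zeros s) = sumn s.
Proof. by rewrite [in RHS](strip_zeros_cat s) sumn_cat sumn_nseq mul0n addn0. Qed.

Lemma altsum_strip_zeros s : altsum (strip_zeros s) = altsum s.
Proof.
elim: s => //= x s IHs; case: ifP => [/andP[/eqP-> /nilP E]|_];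
  rewrite !altsum_cons -IHs //.
by rewrite E /altsum big_ord0.
Qed.

Lemma strip_zeros_inj s s' : size s = size s' -> strip_zeros s = strip_zeros s' -> s = s'.
Proof.
by move=> sz E; rewrite (strip_zeros_cat s) (strip_zeros_cat s') sz E.
Qed.

Lemma strip_zeros_id s : all (ltn 0) s -> strip_zeros s = s.
Proof. by elim: s => //= x s IHs /andP[x0 /IHs->]; case: x x0. Qed.

Lemma strip_zeros_pad s k : strip_zeros (s ++ nseq k 0) = strip_zeros s.
Proof. by elim: s => [|x s IHs] /=; [elim: k => //= k -> | rewrite IHs]. Qed.

Lemma strip_zeros_last s : last 1 (strip_zeros s) != 0.
Proof.
suff: forall y, y != 0 -> last y (strip_zeros s) != 0 by apply.
elim: s => //= x s IHs y y0; have [->|x0] /= := eqVneq x 0; last exact: IHs.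
by case: ifP => //=; case: (strip_zeros s) IHs => //= a u /(_ 1) + _; apply.
Qed.

Lemma all_geq_gt0 (s : seq nat) : sorted geq s -> last 1 s != 0 -> all (ltn 0) s.
Proof.
elim: s => // x s IHs; rewrite /= => srt l0.
have := IHs (path_sorted srt); case: s srt l0 {IHs} => [|y s] /=.
  by rewrite lt0n => _ ->.
by move=> /andP[xy _] l0 /(_ l0) /andP[y0 ->]; rewrite (leq_trans y0 xy) y0.
Qed.

(** Past the last nonzero entry the cross-multiplied inequalities are trivial. Conversely, as
    [N - i.+1 < N - i], they force weak decrease, and the nonzero last entry then makes all stripped
    entries positive. *)
Lemma lecture_hall_strip N s : size s <= N ->
  lecture_hall N (strip_zeros s) <->
  forall i, i.+1 < N -> nth 0 s i.+1 * (N - i) <= nth 0 s i * (N - i.+1).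
Proof.
move=> sN.
have ratio i : i.+1 < N ->
    ((nth 0 s i.+1)%:R / (N - i.+1)%:R <= (nth 0 s i)%:R / (N - i)%:R :> rat)%R
    = (nth 0 s i.+1 * (N - i) <= nth 0 s i * (N - i.+1)).
  move=> iN; rewrite ler_pdivrMr ?ltr0n ?subn_gt0 // mulrAC.
  by rewrite ler_pdivlMr ?ltr0n ?subn_gt0 ?(ltnW iN) // -!natrM ler_nat.
split=> [[_ _ R] i iN|H].
  have [i1|] := ltnP i.+1 (size (strip_zeros s)).
    by rewrite -ratio //; have := R i i1; rewrite !nth_strip_zeros.
  by move=> i1; rewrite -(nth_strip_zeros s i.+1) nth_default.
have szN := leq_trans (size_strip_zeros s) sN.
split=> // [|i i1]; last by rewrite !nth_strip_zeros ratio ?H ?(leq_trans i1).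
have srt : sorted geq (strip_zeros s).
  apply/(sortedP 0) => i i1; rewrite !nth_strip_zeros /=.
  have := H i (leq_trans i1 szN); have := leq_trans i1 szN.
  nia.
by rewrite /is_partition srt all_geq_gt0 ?strip_zeros_last.
Qed.

Lemma padded_reducedP s : reflect
  (forall i, i < size s ->
    low (size s - i.+1) (nth 0 s i.+1) <= nth 0 s i
      < low (size s - i.+1) (nth 0 s i.+1) + (size s - i))
  (padded_reduced s).
Proof.
elim: s => [|x s IHs] /=; first by left.
apply: (iffP and3P) => [[/IHs Rs lx ux] [|i] /= |H].
- by rewrite subSS !subn0 nth0 lx.
- by rewrite ltnS => /Rs; rewrite !subSS.
- have := H 0 isT; rewrite /= subSS !subn0 nth0 => /andP[-> ->]; split=> //.
  by apply/IHs => i i1; have := H i.+1 i1; rewrite /= !subSS.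
Qed.

(** Lowering an entry only relaxes its inequality with the entry before it. Hence it is reducible
    exactly when the lowered value is still at least [low] of the entry after it. *)
Lemma reduced_lecture_hall_strip N s : size s = N ->
  reduced_lecture_hall N (strip_zeros s) <-> padded_reduced s.
Proof.
move=> sN; pose f := nth 0 s.
have szN := size_strip_zeros s; rewrite sN in szN.
have reducible i : i < N -> lecture_hall N (strip_zeros s) ->
    (N - i <= f i /\
     lecture_hall N
       (strip_zeros (set_nth 0 (strip_zeros s) i (f i - (N - i)))))
    <-> low (N - i.+1) (f i.+1) + (N - i) <= f i.
  move=> iN.
  have sg : size (set_nth 0 (strip_zeros s) i (f i - (N - i))) <= N.
    by rewrite size_set_nth geq_max iN.
  have E j : nth 0 (set_nth 0 (strip_zeros s) i (f i - (N - i))) j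
      = if j == i then f i - (N - i) else f j.
    by rewrite nth_set_nth /= nth_strip_zeros.
  rewrite (lecture_hall_strip _ _ sg) lecture_hall_strip ?sN // => H.
  have lowE : low (N - i.+1) (f i.+1) + (N - i) <= f i <-> N - i <= f i /\
      (i.+1 < N -> f i.+1 * (N - i) <= (f i - (N - i)) * (N - i.+1)).
    have [iN1|iN1] := ltnP i.+1 N; last first.
      rewrite (_ : f i.+1 = 0) ?low0; last by rewrite /f nth_default ?sN.
      by split=> [|[]].
    have m0 : 0 < N - i.+1 by lia.
    have := leq_low _ (f i - (N - i)) (f i.+1) m0.
    rewrite (_ : (N - i.+1).+1 = N - i); last lia.
    by move=> L; split=> [le_f|[le_f /(_ isT)]]; rewrite -?L; lia.
  rewrite lowE; split=> -[le_f G]; split=> //.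
    by move=> iN1; have := G i iN1; rewrite !E eqxx; case: eqP => //; lia.
  move=> j jN; rewrite !E; have := H j jN; have [ji|_] := eqVneq j i.
    by rewrite ji gtn_eqF // => _; apply: G; rewrite -ji.
  have [<-|//] := eqVneq j.+1 i; apply: leq_trans.
  by rewrite leq_mul2r leq_subr orbT.
have LH_low : lecture_hall N (strip_zeros s) <->
    forall i, i < N -> low (N - i.+1) (f i.+1) <= f i.
  rewrite lecture_hall_strip ?sN //; split=> H i iN; last first.
    have := H i (ltnW iN); rewrite leq_low ?subn_gt0 //.
    by rewrite (_ : (N - i.+1).+1 = N - i) //; lia.
  have [iN1|iN1] := ltnP i.+1 N; last first.
    by rewrite (_ : f i.+1 = 0) ?low0 // /f nth_default ?sN.
  rewrite leq_low ?subn_gt0 // (_ : (N - i.+1).+1 = N - i); last lia.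
  exact: H.
split=> [[LH red]|/padded_reducedP R].
  apply/padded_reducedP; rewrite sN => i iN.
  rewrite (LH_low.1 LH) //= ltnNge; apply/negP => le_f.
  have [i1|i1] := ltnP i (size (strip_zeros s)).
    by case: (red i i1); rewrite nth_strip_zeros; apply/reducible.
  (* Reducedness does not test padding entries, but a zero is below [N - i]. *)
  have f0 : f i = 0 by rewrite /f -nth_strip_zeros nth_default.
  by move: le_f; rewrite -/f f0; lia.
have LH : lecture_hall N (strip_zeros s).
  by apply/LH_low => i iN; have := R i; rewrite sN => /(_ iN) /andP[].
split=> // i i1; have iN := leq_trans i1 szN.
rewrite nth_strip_zeros => /(reducible i iN LH).
by have := R i; rewrite sN => /(_ iN) /andP[_]; rewrite ltnNge => /negP.
Qed.

End LectureHall.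

(** * Evaluation of both sums *)

Local Open Scope ring_scope.

(** Removes the absolute value in [alt_size], so that the recursion is linear. *)
Lemma padded_reduced_altsum_ge0 s : padded_reduced s -> 0 <= altsum s.
Proof.
move=> Rs; rewrite -altsum_strip_zeros; apply: altsum_ge0.
by have [[]] := (reduced_lecture_hall_strip _ _ (erefl (size s))).2 Rs.
Qed.

Lemma padded_reduced_gf N : exists L : seq (seq nat), [/\ uniq L,
    forall s, s \in L <-> size s = N /\ padded_reduced s &
    forall (R : comPzRingType) (t q : R),
      \sum_(s <- L) t ^+ alt_size s * q ^+ sumn s =
      \prod_(1 <= k < N.+1) \sum_(s < (N - k + 1)%N) (t * q ^+ (2 * k - 1)) ^+ s].
Proof.
apply: (gf_of_recursion _ (fun n s => size s = n /\ padded_reduced s) [::]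
  (fun n s mu => (low n (head 0%N mu) + s)%N :: reflect_even mu)) => //.
- by rewrite /alt_size /altsum big_ord0.
- by move=> s; split=> [[/size0nil]|->].
- exact: padded_reducedS.
- move=> n s s' mu mu' [_ Rmu] [_ Rmu'] [es /(congr1 reflect_even)].
  by rewrite !reflect_evenK // => emu; subst mu'; split=> //; exact: addnI es.
- move=> n s mu [<- Rmu]; rewrite /alt_size altsum_cons /=.
  have [-> /= sumE] := altsum_sumn_reflect_even mu Rmu.
  by have := padded_reduced_altsum_ge0 mu Rmu; split; lia.
Qed.

(** Stripping zeros is injective at fixed length and preserves both statistics. *)
Lemma fps_sum_reduced_lecture_hall N :
  fps_sum (reduced_lecture_hall N)
    (fun mu => tvar ^+ alt_size mu * qvar ^+ sumn mu)
  = \prod_(1 <= k < N.+1)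
      \sum_(s < (N - k + 1)%N) (tvar * qvar ^+ (2 * k - 1)) ^+ s.
Proof.
have [L [uL inL <-]] := padded_reduced_gf N.
rewrite (fps_sum_seq _ _ _ (map strip_zeros L)).
- rewrite big_map; apply: eq_bigr => s _.
  by rewrite /alt_size altsum_strip_zeros sumn_strip_zeros.
- rewrite map_inj_in_uniq // => s s' /inL[sz _] /inL[sz' _].
  by apply: strip_zeros_inj; rewrite sz.
move=> mu; split=> [/mapP[s /inL[sz Rs] ->]|Rmu].
  by apply/reduced_lecture_hall_strip.
have [[/andP[_ mu0] szN _] _] := Rmu.
have E : strip_zeros (mu ++ nseq (N - size mu) 0%N) = mu.
  by rewrite strip_zeros_pad strip_zeros_id.
have sz : size (mu ++ nseq (N - size mu) 0%N) = N by rewrite size_cat size_nseq subnKC.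
rewrite -E; apply/map_f/inL; split=> //.
by apply/(reduced_lecture_hall_strip N) => //; rewrite E.
Qed.

Lemma fps_sum_reduced_odd_partitions N :
  fps_sum (reduced_odd_partitions N)
    (fun la => tvar ^+ size la * qvar ^+ sumn la)
  = \prod_(1 <= k < N.+1)
      \sum_(s < (N - k + 1)%N) (tvar * qvar ^+ (2 * k - 1)) ^+ s.
Proof.
have [||L [uL inL <-]] := gf_of_recursion _ _ [::] (fun=> add_ones) size sumn
  erefl erefl reduced_odd_partitions0 reduced_odd_partitionsS _ _ N.
- by move=> n s s' la la' _ _; apply: add_ones_inj.
- by move=> n s la _; rewrite size_add_ones sumn_add_ones.
exact: fps_sum_seq.
Qed.

Theorem theorem4p3 (N : nat) (N_gt0 : (0 < N)%N) :
  fps_sum (reduced_odd_partitions N)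
    (fun la => tvar ^+ size la * qvar ^+ sumn la)
  = fps_sum (reduced_lecture_hall N)
      (fun mu => tvar ^+ alt_size mu * qvar ^+ sumn mu)
  /\
  fps_sum (reduced_lecture_hall N)
    (fun mu => tvar ^+ alt_size mu * qvar ^+ sumn mu)
  = \prod_(1 <= k < N.+1)
      ((1 - tvar ^+ (N - k + 1) * qvar ^+ trapezoidal N k)
       / (1 - tvar * qvar ^+ (2 * k - 1))).
Proof.
rewrite fps_sum_reduced_odd_partitions fps_sum_reduced_lecture_hall; split=> //.
(* Each factor is a geometric sum in z = t q^(2k-1), and 1 - z is invertible because 2k - 1 > 0. *)
apply: eq_big_nat => k kN; rewrite geometric_quotient; last first.
  by apply: unit_1Btq; lia.
by rewrite trapezoidalE // exprMn -exprM.
Qed.
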